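(* Let $p>13$ be a prime. There is no subgroup $H$ of the multiplicative group $\mathbb{F}_p^\times$ and no element $g\in\mathbb{F}_p^\times$ such that the coset $A=gH=\{gh\colon h\in H\}$ satisfies $A-A\doteq\mathcal{R}_p$.
   Context: $\mathbb{F}_p$ is the field with $p$ elements and $\mathcal{R}_p\subseteq\mathbb{F}_p$ denotes the set of nonzero quadratic residues modulo $p$. For subsets $A,S$ of an abelian group, $A-A\doteq S$ means: every element of $S$ has exactly one representation as $a'-a''$ with $a',a''\in A$, and every difference $a'-a''$ with $a',a''\in A$, $a'\ne a''$, belongs to $S$. *)

(* Defs.v *)
From HB Require Import structures.
From mathcomp Require Import all_boot all_order all_algebra all_fingroup.
Set Implicit Arguments. Unset Strict Implicit. Unset Printing Implicit Defensive.
Import GRing.Theory.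
Local Open Scope ring_scope.

Definition diff_rep (G : finZmodType) (A S : {set G}) : Prop :=
  (forall s, s \in S ->
     #|[set x : G * G | [&& x.1 \in A, x.2 \in A & x.1 - x.2 == s]]| = 1%N)
  /\ (forall a b, a \in A -> b \in A -> a != b -> a - b \in S).

Definition qres (p : nat) : {set 'F_p} :=
  [set x : 'F_p | (x != 0) && [exists y : 'F_p, y ^+ 2 == x]].

Definition unit_coset (p : nat) (g : {unit 'F_p}) (H : {group {unit 'F_p}})
  : {set 'F_p} := [set val (g * h)%g | h in H].

(* Main.v *)
(* With n = |H|, counting gives p = 2 n (n - 1) + 1, and uniqueness of
   representations forces -1 \notin H, hence n is odd.  The product of all
   nonzero quadratic residues is -1; computed from the differences g h (u - 1),
   h, u \in H, u != 1, it is g^(n (n - 1)) n^n, where g^(n (n - 1)) = +-1 is the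
   quadratic character of g.  As H is the set of roots of X^n - 1, either n or
   -n lies in H modulo p, and 2 n^2 - 2 n + 1 = 0 there yields 2 n^3 = n - 1.
   - If g is a residue, u = -n \in H and 1 - u^3 = u^3 - u contradicts
     uniqueness.
   - If g is a nonresidue, u = n \in H and u - u^3 = 1 + u^3; but g (u - u^3) is
     a residue, and so is 1 + u^3 = g (1 - u^6) / (g (1 - u^3)). *)
Require Import Defs.
From HB Require Import structures.
From mathcomp Require Import all_boot all_order all_algebra all_fingroup.
From mathcomp Require Import cyclic ring zify.
Set Implicit Arguments. Unset Strict Implicit. Unset Printing Implicit Defensive.
Import GRing.Theory.

Section FieldUnitSubgroups.

Local Open Scope ring_scope.

Variables (F : finFieldType) (G : {group {unit F}}).

(** By Lagrange the elements of [G] are roots of the right-hand side, and they are as many as its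
    degree. Membership in [G] thus becomes a power equation, and evaluations give products over
    [G]. *)
Lemma prod_XsubC_unit_group :
  \prod_(u in G) ('X - (val u)%:P) = 'X^#|G| - 1 :> {poly F}.
Proof.
pose rs := [seq val u | u <- enum G].
have sz : size rs = #|G| by rewrite size_map -cardE.
have Urs : uniq rs by rewrite map_inj_uniq ?enum_uniq //; exact: val_inj.
have Rrs : all (root ('X^#|G| - 1)) rs.
  apply/allP => y /mapP[u]; rewrite mem_enum => Gu ->.
  by rewrite rootE !hornerE -FinRing.val_unitX expg_cardG // subrr.
rewrite (all_roots_prod_XsubC _ Rrs) ?uniq_rootsE //.
  rewrite lead_coefDl ?size_polyXn ?size_polyN ?size_poly1 ?ltnS ?cardG_gt0 //.
  by rewrite lead_coefXn scale1r big_map big_enum.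
by rewrite sz size_XnsubC ?cardG_gt0.
Qed.

Lemma expf_card_unit_group (u : {unit F}) :
  (u \in G) = (val u ^+ #|G| == 1).
Proof.
have: root (\prod_(v in G) ('X - (val v)%:P)) (val u) = (u \in G).
  rewrite -big_enum -(big_map val xpredT (fun x => 'X - x%:P)) root_prod_XsubC.
  by rewrite mem_map ?mem_enum //; exact: val_inj.
by rewrite prod_XsubC_unit_group rootE !hornerE subr_eq0 => ->.
Qed.

Lemma prod_unit_group : \prod_(u in G) val u = (-1) ^+ #|G|.+1.
Proof.
have /(congr1 (fun q : {poly F} => q.[0])) := prod_XsubC_unit_group.
rewrite horner_prod !hornerE expr0n gtn_eqF ?cardG_gt0 // add0r.
under eq_bigr do rewrite !hornerE.
rewrite prodrN exprSr => /(congr1 ( *%R ((-1) ^+ #|G|))).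
by rewrite mulrA -exprMn mulrNN mulr1 expr1n mul1r.
Qed.

Lemma prod_1sub_unit_group : \prod_(u in (G^#)%g) (1 - val u) = #|G|%:R.
Proof.
have := prod_XsubC_unit_group.
(* Cancelling ['X - 1] leaves the geometric sum, whose value at 1 is the number of its terms. *)
rewrite (big_setD1 1%g) //= subrX1 => /(mulfI (negbT (polyXsubC_eq0 _))).
move=> /(congr1 (fun q : {poly F} => q.[1])).
rewrite horner_prod horner_sum.
under eq_bigr do rewrite !hornerE.
under [RHS]eq_bigr do rewrite !hornerE expr1n.
by move->; rewrite sumr_const card_ord.
Qed.

End FieldUnitSubgroups.

(** The unit group is cyclic of even order, so its squares are generated by the square of a
    generator. *)
Lemma qres_unit_group (p : nat) : prime p -> 2 < p ->
  exists2 Q : {group {unit 'F_p}},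
    #|Q|.*2 = p.-1 & qres p = [set val u | u in Q].
Proof.
move=> p_pr p_gt2; have p_odd : odd p by apply: contraTT p_gt2 => /prime_oddPn->.
have /cyclicP[x defx] := field_unit_group_cyclic [group of [set: {unit 'F_p}]].
have ox : #[x]%g = p.-1 by rewrite orderE -defx card_finField_unit card_Fp.
have dvd2 : 2 %| #[x]%g by rewrite ox dvdn2 -subn1 oddB ?prime_gt0 // p_odd.
exists <[x ^+ 2]>%G.
  by rewrite -orderE orderXdiv // -muln2 divnK // ox.
apply/setP => z; rewrite inE; apply/andP/imsetP => [[z0 /existsP[y /eqP yz]]|].
  have y0 : y != 0%R by apply: contraNneq z0 => y0; rewrite -yz y0 expr0n.
  have Uy : y \is a GRing.unit by rewrite unitfE.
  have /cycleP[i xi] : FinRing.Unit Uy \in <[x]>%g by rewrite -defx inE.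
  exists (x ^+ 2 ^+ i)%g; first exact: mem_cycle.
  by rewrite -expgM mulnC expgM -xi FinRing.val_unitX.
move=> [u /cycleP[i ->] ->]; split; first by rewrite -unitfE; exact: valP.
by apply/existsP; exists (val (x ^+ i)%g); rewrite -FinRing.val_unitX -!expgM mulnC.
Qed.

Section CosetDifferences.

Local Open Scope ring_scope.

Variables (p : nat) (H : {group {unit 'F_p}}) (g : {unit 'F_p}).
Hypothesis repH : diff_rep (unit_coset g H) (qres p).

Let A_H a : a \in H -> val g * val a \in unit_coset g H.
Proof. by move=> Ha; apply/imsetP; exists a; rewrite ?FinRing.val_unitM. Qed.

Let gI (a b : {unit 'F_p}) : val g * val a = val g * val b -> a = b.
Proof. by rewrite -!FinRing.val_unitM => /val_inj/mulgI. Qed.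

Lemma coset_diff_qres a b : a \in H -> b \in H -> a != b ->
  val g * (val a - val b) \in qres p.
Proof.
move=> Ha Hb ab; rewrite mulrBr; apply: repH.2; rewrite ?A_H //.
by apply: contra_neq ab => /gI.
Qed.

(** Scaling by [g] carries uniqueness of representations from the coset to [H] itself; every later
    contradiction with uniqueness goes through this form. *)
Lemma coset_diff_inj a b c d :
  a \in H -> b \in H -> c \in H -> d \in H -> a != b ->
  val a - val b = val c - val d -> a = c.
Proof.
move=> Ha Hb Hc Hd ab eqd.
have /eqP/cards1P[q defq] := repH.1 _ (coset_diff_qres Ha Hb ab).
have: (val g * val a, val g * val b) \in [set q].
  by rewrite -defq inE !A_H // -mulrBr /=.
have: (val g * val c, val g * val d) \in [set q].
  by rewrite -defq inE !A_H // -mulrBr eqd /=.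
by rewrite !inE => /eqP<- /eqP /(congr1 fst) /gI.
Qed.

(** Writing a difference through the ratio [w.2] of its two terms makes the product over all pairs
    factor. *)
Let phi (w : {unit 'F_p} * {unit 'F_p}) : 'F_p :=
  val g * val w.1 * (val w.2 - 1).

Lemma qres_coset_diff : qres p = phi @: setX H H^#%g.
Proof.
apply/setP=> s; apply/idP/imsetP=> [Rs | [[h u] /setXP[/= Hh /setD1P[u1 Hu]] ->]].
  have /eqP/cards1P[[x y] defq] := repH.1 _ Rs.
  have: (x, y) \in [set (x, y)] by rewrite inE.
  rewrite -defq inE /= => /and3P[/imsetP[a Ha ->] /imsetP[b Hb ->] /eqP defs].
  exists (b, b^-1 * a)%g.
    rewrite inE /= Hb !inE groupM ?groupV // andbT.
    rewrite -(inj_eq (mulgI b)) mulKVg mulg1; apply: contraTneq Rs => ab.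
    by rewrite -defs ab subrr inE eqxx.
  by rewrite -defs /phi /= mulrBr mulr1 -mulrA (mulVKr (valP b)).
rewrite /phi /= -mulrA mulrBr mulr1 -FinRing.val_unitM coset_diff_qres ?groupM //.
by rewrite -{2}[h]mulg1 (inj_eq (mulgI h)).
Qed.

Lemma coset_diff_injective : {in setX H H^#%g &, injective phi}.
Proof.
move=> [h u] [k v] /setXP[/= Hh /setD1P[u1 Hu]] /setXP[/= Hk /setD1P[v1 Hv]].
rewrite /phi /= -!mulrA => /(mulrI (valP g)); rewrite !mulrBr !mulr1.
rewrite -!FinRing.val_unitM => eqd.
have eq1 : (h * u = k * v)%g.
  apply: (coset_diff_inj _ _ _ _ _ eqd); rewrite ?groupM //.
  by rewrite -{2}[h]mulg1 (inj_eq (mulgI h)).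
have eq2 : h = k by apply: val_inj; apply: oppr_inj; move: eqd; rewrite eq1 => /addrI.
by move: eq1; rewrite eq2 => /mulgI->.
Qed.

Let cardH1 : #|H^#%g| = #|H|.-1.
Proof. by rewrite [in RHS](cardsD1 1%g) group1. Qed.

Lemma card_qres_coset : #|qres p| = (#|H| * #|H|.-1)%N.
Proof.
rewrite qres_coset_diff card_in_imset ?cardsX ?cardH1 //.
exact: coset_diff_injective.
Qed.

Lemma opp1_notin_coset u : (2 < #|H|)%N -> u \in H -> val u != -1.
Proof.
move=> H_gt2 Hu; apply/eqP => u1.
have /card_gt0P[h] : (0 < #|H :\ 1%g :\ u|)%N.
  have := leq_b1 (u \in H :\ 1%g); move: H_gt2.
  by rewrite (cardsD1 1%g H) (cardsD1 u (H :\ 1%g)) group1; lia.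
rewrite !inE => /and3P[hu h1 Hh]; case/eqP: hu.
(* If [u] is -1, then [h - 1 = u - u * h] represents one difference twice. *)
apply: (@coset_diff_inj h 1%g u (u * h)%g) => //; first exact: groupM.
by rewrite FinRing.val_unitM u1 mulN1r opprK addrC.
Qed.

Lemma odd_coset : (2 < #|H|)%N -> odd #|H|.
Proof.
move=> H_gt2; apply: contraT => ev.
have U1 : (-1 : 'F_p) \is a GRing.unit by rewrite unitrN1.
have : FinRing.Unit U1 \in H.
  by rewrite expf_card_unit_group /= -signr_odd (negbTE ev).
by move/(opp1_notin_coset H_gt2); rewrite eqxx.
Qed.

(* Both sides are the product of all nonzero quadratic residues. *)
Lemma coset_product : prime p -> (2 < p)%N -> (2 < #|H|)%N ->
  val g ^+ (#|H| * #|H|.-1) * #|H|%:R ^+ #|H| = -1.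
Proof.
move=> p_pr p_gt2 H_gt2; have oddH := odd_coset H_gt2.
have ev : ~~ odd #|H|.-1 by case: #|H| oddH => //= n; rewrite negbK.
have prodH : \prod_(u in H) val u = 1.
  by rewrite prod_unit_group -signr_odd /= oddH.
have prodH1 : \prod_(u in H^#%g) (val u - 1) = #|H|%:R.
  under eq_bigr do rewrite -opprB.
  rewrite prodrN prod_1sub_unit_group -signr_odd.
  by rewrite cardH1 (negbTE ev) mul1r.
have [Q _ defQ] := qres_unit_group p_pr p_gt2.
have cardQ : #|Q| = (#|H| * #|H|.-1)%N.
  by rewrite -card_qres_coset defQ card_imset //; exact: val_inj.
have prodQ : \prod_(r in qres p) r = -1.
  rewrite defQ big_imset /=; last by move=> ? ? _ _; exact: val_inj.
  by rewrite prod_unit_group exprS -signr_odd cardQ oddM (negbTE ev) andbF mulr1.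
rewrite -prodQ qres_coset_diff big_imset /=; last exact: coset_diff_injective.
under eq_bigl do rewrite inE.
rewrite -(pair_big (fun h => h \in H) (fun u => u \in H^#%g)
            (fun h u => phi (h, u))) /= /phi /=.
under eq_bigr => h _ do rewrite big_split /= prodH1 prodr_const.
rewrite big_split /= prodr_const cardH1.
rewrite prodrXl big_split /= prodH mulr1 prodr_const -exprM //.
Qed.

End CosetDifferences.

Theorem theorem1 (p : nat) (p_pr : prime p) (p_gt13 : 13 < p)
  (H : {group {unit 'F_p}}) (g : {unit 'F_p}) :
  ~ diff_rep (unit_coset g H) (qres p).
Proof.
Local Open Scope ring_scope.
move=> repH; have p_gt2 : (2 < p)%N by apply: leq_trans p_gt13.
have [Q cardQ defQ] := qres_unit_group p_pr p_gt2.
(* Euler's criterion: [#|Q|] is half of [p - 1]. *)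
have Qm r : r \in qres p -> r ^+ #|Q| = 1.
  by rewrite defQ => /imsetP[u Qu ->]; apply/eqP; rewrite -expf_card_unit_group.
have cardQH : #|Q| = (#|H| * #|H|.-1)%N.
  by rewrite -(card_qres_coset repH) defQ card_imset //; exact: val_inj.
have defp : p = (#|H| * #|H|.-1).*2.+1 by rewrite -cardQH cardQ prednK ?prime_gt0.
have H_gt2 : (2 < #|H|)%N.
  by rewrite ltnNge; apply/negP => H_le2; move: p_gt13; rewrite defp; nia.
have oddH := odd_coset repH H_gt2.
have nz k : (0 < k < p)%N -> k%:R != 0 :> 'F_p.
  by case/andP=> k0 kp; rewrite -(dvdn_pcharf (pchar_Fp p_pr)) gtnNdvd.
(* Needed for 2, 5 and 13, the values to which the degenerate cases reduce. *)
have nzp k : (0 < k < 14)%N -> k%:R != 0 :> 'F_p.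
  by case/andP=> k0 k14; rewrite nz // k0 (leq_trans k14).
have N2 : 2%:R * #|H|%:R ^+ 2 - 2%:R * #|H|%:R + 1 = 0 :> 'F_p.
  have := pchar_Fp_0 p_pr; rewrite [_%:R](congr1 (fun k => k%:R : 'F_p) defp).
  case: #|H| H_gt2 => // n _ /=; rewrite -mul2n !(mulrS, natrM) => <-; ring.
have := coset_product repH p_pr p_gt2 H_gt2; rewrite -cardQH.
have: (val g ^+ #|Q|) ^+ 2 == 1.
  rewrite -exprM mulnC exprM Qm // inE expf_eq0 /= -unitfE (valP g).
  by apply/existsP; exists (val g).
set N : 'F_p := #|H|%:R in N2 *.
have N3 : 2%:R * N ^+ 3 = N - 1.
  (* The factor [N + 1] is chosen to cancel the quadratic term. *)
  have: (N + 1) * (2%:R * N ^+ 2 - 2%:R * N + 1) = 0 by rewrite N2 mulr0.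
  by move=> e; apply/eqP; rewrite -subr_eq0 -e; apply/eqP; ring.
have inH x : x ^+ #|H| = 1 -> exists2 u, u \in H & val u = x.
  move=> xH; have Ux : x \is a GRing.unit.
    by rewrite -(unitrX_pos _ (cardG_gt0 H)) xH unitr1.
  by exists (FinRing.Unit Ux); rewrite // expf_card_unit_group /= xH.
have one1 : val (1%g : {unit 'F_p}) = 1 by [].
rewrite sqrf_eq1 => /orP[] /eqP g1; rewrite g1.
  rewrite mul1r => NH.
  have [u Hu uN] : exists2 u, u \in H & val u = - N.
    by apply: inH; rewrite exprNn -signr_odd oddH NH mulrNN mulr1.
  have u3 : val (u ^+ 3)%g = - N ^+ 3.
    by rewrite FinRing.val_unitX uN; ring.
  (* Otherwise [1 - u^3 = u^3 - u] would be two representations of a nonzero difference. *)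
  have u31 : (u ^+ 3 = 1)%g.
    apply/eqP; apply: contraT => u31.
    rewrite eq_sym in u31; case/eqP: (u31).
    apply: (coset_diff_inj repH _ _ _ Hu u31); rewrite ?groupX //.
    rewrite u3 uN one1; apply/eqP; rewrite -subr_eq0; apply/eqP.
    by transitivity (2%:R * N ^+ 3 - (N - 1)); [ring | rewrite N3 subrr].
  have N31 : N ^+ 3 = -1 by rewrite -[LHS]opprK -u3 u31.
  have N1 : N = -1.
    by rewrite -[LHS](subrK 1) -N3 N31; ring.
  (* At [N = -1] the quadratic relation reads [5 = 0]. *)
  by have := nzp 5 isT; rewrite -N2 N1 => /eqP[]; ring.
rewrite mulN1r => /oppr_inj NH.
have [u Hu uN] := inH N NH.
have u3 : val (u ^+ 3)%g = N ^+ 3 by rewrite FinRing.val_unitX uN.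
have u31 : (1%g != u ^+ 3)%g.
  (* If [N^3 = 1] then [N = 3], and the quadratic relation reads [13 = 0]. *)
  apply: contra_not_neq (elimN eqP (nzp 13 isT)) => u31.
  have N31 : N ^+ 3 = 1 by rewrite -u3 -u31.
  have N1 : N = 3%:R by rewrite -[LHS](subrK 1) -N3 N31; ring.
  by rewrite -N2 N1; ring.
have opp1 v := opp1_notin_coset repH (u := v) H_gt2.
(* [N^3 = N] and [2 N^3 = N - 1] would give [N = -1], which is not in [H]. *)
have uu3 : (u != u ^+ 3)%g.
  apply: contraNneq (opp1 u Hu) => uu3.
  have N33 : N ^+ 3 = N by rewrite -u3 -uu3.
  rewrite uN; apply/eqP.
  by transitivity (2%:R * N ^+ 3 - N); [rewrite N33 | rewrite N3]; ring.
(* Otherwise [u^3] would be 1 or -1, both excluded. *)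
have u61 : (1%g != u ^+ 6)%g.
  apply: contraNneq (opp1 _ (groupX 3 Hu)) => u61.
  have: val (u ^+ 3)%g ^+ 2 == 1 by rewrite -FinRing.val_unitX -expgM -u61.
  rewrite sqrf_eq1 => /orP[|//] /eqP u3_1; case/eqP: u31.
  exact: val_inj.
have Q3 := Qm _ (coset_diff_qres repH (group1 H) (groupX 3 Hu) u31).
have Q6 := Qm _ (coset_diff_qres repH (group1 H) (groupX 6 Hu) u61).
have Q13 := Qm _ (coset_diff_qres repH Hu (groupX 3 Hu) uu3).
have u6 : val (u ^+ 6)%g = (N ^+ 3) ^+ 2 by rewrite FinRing.val_unitX uN; ring.
have D3 : (1 + N ^+ 3) ^+ #|Q| = 1.
  move: Q3 Q6; rewrite one1 u3 u6 => Q3.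
  have -> : val g * (1 - (N ^+ 3) ^+ 2) = val g * (1 - N ^+ 3) * (1 + N ^+ 3) by ring.
  by rewrite exprMn Q3 mul1r.
have dN : val u - val (u ^+ 3)%g = 1 + N ^+ 3.
  by rewrite u3 uN; transitivity (N - 1 - N ^+ 3 + 1); [ring | rewrite -N3; ring].
(* The residue [g (u - u^3)] has power 1, yet its factors give [g ^+ #|Q| = -1], so [2 = 0]. *)
move: Q13; rewrite dN exprMn D3 mulr1 g1 => e.
by have/eqP := nzp 2 isT; apply; rewrite mulr2n -{1}e addNr.
Qed.
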